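(* For each integer $m>0$ there exists a continuous map $f:I\to I$ of the interval $I=[0,1]$ to itself such that: (1) $f$ is $2$-fold on all of $I$; (2) $f$ is $m$-fold on a set $Y=I\setminus K$, where $K\subset I$ is a nowhere dense, closed, uncountable set; (3) $h_{top}(f)=\log 2$.
   Context: A continuous map $f:X\to X$ is $k$-fold on a subset $Y\subset X$ if every point of $Y$ has at least $k$ preimages in $X$ under $f$. $h_{top}$ denotes topological entropy. *)

(* Defs.v *)
From HB Require Import structures.
From mathcomp Require Import all_boot all_order all_algebra finmap.
From mathcomp Require Import all_classical all_reals all_analysis.
Import Order.TTheory GRing.Theory Num.Theory.
Import numFieldNormedType.Exports.

Set Implicit Arguments.
Unset Strict Implicit.
Unset Printing Implicit Defensive.

Local Open Scope classical_set_scope.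
Local Open Scope card_scope.
Local Open Scope ring_scope.

Definition kfold {X : Type} (f : X -> X) (k : nat) (Y : set X) : Prop :=
  forall y : X, Y y -> `I_k #<= f @^-1` [set y].

Definition nowhere_dense {X : topologicalType} (A : set X) : Prop :=
  (closure A)° = set0.

(* Topological entropy of a self-map of a compact (pseudo)metric space,
   following Bowen.  [~ ball x eps y] says that x and y are at distance at
   least [eps], so distinct points of [E] are [eps]-apart for the n-th Bowen
   distance, the maximum over i < n of the distances between i-th iterates. *)
Definition bowen_separated {R : realType} {X : pseudoMetricType R}
    (f : X -> X) (n : nat) (eps : R) (E : {fset X}) : Prop :=
  forall x y : X, x \in E -> y \in E -> x != y ->
    exists2 i : nat, (i < n)%N & ~ ball (iter i f x) eps (iter i f y).

Definition sep_number {R : realType} {X : pseudoMetricType R}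
    (f : X -> X) (n : nat) (eps : R) : \bar R :=
  ereal_sup [set (#|` E|%:R)%:E | E in bowen_separated f n eps].

(* The value at n = 0 is irrelevant to the upper limit.  The upper limit is
   nonincreasing in [eps], so the limit as [eps] tends to 0 from the right
   always exists in the extended reals. *)
Definition topological_entropy {R : realType} {X : pseudoMetricType R}
    (f : X -> X) : \bar R :=
  lim ((limn_esup (fun n : nat => (n%:R^-1)%:E * lne (sep_number f n eps))%E)
         @[eps --> (0 : R)^'+]).

(* The subtype carrying the topology and the distance induced from R. *)
Definition unit_interval (R : realType) : pseudoMetricType R :=
  set_type `[(0 : R), 1]%classic.

(* Main.v *)
Require Import Defs.
From mathcomp Require Import all_boot all_order all_algebra finmap.
From mathcomp Require Import all_classical all_reals all_analysis.
From mathcomp Require Import lra zify.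
Import Order.TTheory GRing.Theory Num.Theory.
Import numFieldNormedType.Exports.
Local Open Scope classical_set_scope.
Local Open Scope ring_scope.

Set Implicit Arguments.
Unset Strict Implicit.

(* Let C be the ternary Cantor set and t = min(1, 3x, 3 - 3x) the truncated
   tent map, which maps every gap of C onto a gap, except the middle third, where
   it is constant. Let g be the map that fixes C pointwise and stretches
   each gap over itself by a three-lap zigzag. The map is f = g^m o t: each
   point has two preimages under t, and each point off C more than m under g^m.

   The m-fold folding costs no entropy since it takes place in the gaps: f maps
   the cylinder sets of C like t does, so that a gap shrinks backwards in time
   and becomes a point forwards in time. For a scale eps, fix N such that
   cylinders of rank N are smaller than eps, and let a_n be the number of
   eps-small sets for the n-th Bowen distance needed to cover a cylinder of rank
   N. Such a cylinder consists of a gap, covered by D sets independently of n,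
   and two cylinders that f maps into cylinders of rank N; so
   a_(n+1) <= 2 a_n + D and a_n = O(2^n). Conversely the 2^n images of 0 under
   the compositions of n inverse branches of t are separated at scale 1/3. *)

(** * Preliminaries on the real line and the three-lap zigzag *)

Lemma exists_expr_third_lt {R : realType} (e : R) :
  0 < e -> exists n, 3^-1 ^+ n < e.
Proof.
move=> e0; have h : `|3^-1 : R| < 1 by rewrite ger0_norm//; lra.
have /cvgr0_norm_lt/(_ _ e0)[n _ /(_ n (leqnn n))] := cvg_expr h.
by rewrite normrX ger0_norm//; exists n.
Qed.

Lemma closure_inf {R : realType} (A : set R) :
  has_inf A -> closure A (inf A).
Proof.
move=> iA U /nbhs_ballP[e /= e0 eU].
have [a Aa ae] := inf_adherent e0 iA.
exists a; split=> //; apply: eU.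
rewrite /ball /= distrC ger0_norm; first by lra.
by rewrite subr_ge0; apply: ge_inf => //; case: iA.
Qed.

(* For [a <= b], the three-lap piecewise affine map of [[a, b]] onto itself
   that fixes [a] and [b]. *)
Definition zigzag {R : realType} (a b x : R) : R :=
  Num.max (Num.min (3 * x - 2 * a) (2 * a + 2 * b - 3 * x)) (3 * x - 2 * b).

Lemma zigzagP {R : realType} (a b x : R) : a <= b ->
  [\/ 3 * x <= 2 * a + b /\ zigzag a b x = 3 * x - 2 * a,
      2 * a + b <= 3 * x <= a + 2 * b /\
        zigzag a b x = 2 * a + 2 * b - 3 * x |
      a + 2 * b <= 3 * x /\ zigzag a b x = 3 * x - 2 * b].
Proof.
move=> ab; rewrite /zigzag.
case: (leP (3 * x - 2 * a) (2 * a + 2 * b - 3 * x)) => h.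
  case: (leP (3 * x - 2 * a) (3 * x - 2 * b)) => h'.
    have e : a = b by lra.
    by constructor 1; split; lra.
  by constructor 1; split; lra.
case: (leP (2 * a + 2 * b - 3 * x) (3 * x - 2 * b)) => h'.
  by constructor 3; split; lra.
by constructor 2; split; lra.
Qed.

(** * Folding the gaps of a closed set *)

Section GapFold.
Context {R : realType} (C : set R).
Hypotheses (clC : closed C) (C0 : C 0) (C1 : C 1).

(** For [x] in the unit interval but off [C], [gap_left x] and [gap_right x] are the endpoints of
    the gap around [x]. On [C] both equal [x], and the zigzag degenerates to the identity. *)
Definition gap_left (x : R) : R := sup [set c | C c /\ c <= x].

Definition gap_right (x : R) : R := inf [set c | C c /\ x <= c].

Definition gap_fold (x : R) : R := zigzag (gap_left x) (gap_right x) x.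

Let has_below (x : R) : 0 <= x -> has_sup [set c | C c /\ c <= x].
Proof. by move=> x0; split; [exists 0 | exists x => c []]. Qed.

Let has_above (x : R) : x <= 1 -> has_inf [set c | C c /\ x <= c].
Proof. by move=> x1; split; [exists 1 | exists x => c []]. Qed.

Lemma gap_left_in (x : R) : 0 <= x -> C (gap_left x).
Proof.
move=> /has_below[ne ub]; apply: clC.
by apply: closureS (closure_sup ne ub) => c [].
Qed.

Lemma gap_left_le (x : R) : 0 <= x -> gap_left x <= x.
Proof. by move=> /has_below[ne _]; apply: ge_sup => // c []. Qed.

Lemma le_gap_left (x c : R) : 0 <= x -> C c -> c <= x -> c <= gap_left x.
Proof. by move=> /has_below s Cc cx; apply: ub_le_sup; [case: s|]. Qed.

Lemma gap_right_in (x : R) : x <= 1 -> C (gap_right x).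
Proof.
move=> /has_above ix; apply: clC.
by apply: closureS (closure_inf ix) => c [].
Qed.

Lemma le_gap_right (x : R) : x <= 1 -> x <= gap_right x.
Proof. by move=> /has_above[ne _]; apply: lb_le_inf => // c []. Qed.

Lemma gap_right_le (x c : R) : x <= 1 -> C c -> x <= c -> gap_right x <= c.
Proof. by move=> /has_above s Cc xc; apply: ge_inf; [case: s|]. Qed.

Lemma gap_fold_fix x : 0 <= x <= 1 -> C x -> gap_fold x = x.
Proof.
move=> /andP[x0 x1] Cx.
have l : gap_left x = x.
  by apply/eqP; rewrite eq_le gap_left_le//= le_gap_left.
have r : gap_right x = x.
  by apply/eqP; rewrite eq_le le_gap_right//= gap_right_le.
rewrite /gap_fold l r.
by have [[]|[]|[]] := zigzagP x (lexx x); lra.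
Qed.

Lemma gap_fold_gap x : 0 <= x <= 1 -> gap_left x <= gap_fold x <= gap_right x.
Proof.
move=> /andP[x0 x1]; have := gap_left_le x0; have := le_gap_right x1.
rewrite /gap_fold; move: (gap_left x) (gap_right x) => a b xb ax.
by have [[]|[]|[]] := zigzagP x (le_trans ax xb); lra.
Qed.

(** The gap endpoints are the points of [C] nearest to [x] on either side, so the whole gap lies
    between [c] and [d]. This invariance is why folding respects the cylinders of the tent map. *)
Lemma gap_fold_itv c d x : 0 <= x <= 1 -> C c -> C d -> c <= x <= d ->
  c <= gap_fold x <= d.
Proof.
move=> x01 Cc Cd /andP[cx xd]; have /andP[lf fr] := gap_fold_gap x01.
move: x01 => /andP[x0 x1].
by rewrite (le_trans _ lf) ?le_gap_left//= (le_trans fr)// gap_right_le.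
Qed.

(** If a point of [C] separates [x] from [y], each value is compared with the gap endpoint facing
    the other point: the zigzag at most triples the distance to it. Otherwise [x] and [y] share a
    gap, where the slopes are 3 and -3. One constant for all gaps yields continuity. *)
Lemma gap_fold_lipschitz x y : 0 <= x <= 1 -> 0 <= y <= 1 ->
  `|gap_fold x - gap_fold y| <= 3 * `|x - y|.
Proof.
wlog xy : x y / x <= y.
  move=> h x01 y01; have [xy|yx] := leP x y; first exact: h.
  by rewrite distrC (distrC x); apply: h => //; exact: ltW.
move=> x01 y01; move: (x01) (y01) => /andP[x0 x1] /andP[y0 y1].
have -> : `|x - y| = y - x by rewrite distrC ger0_norm// subr_ge0.
have [[c [Cc /andP[xc cy]]]|noC] := pselect (exists c, C c /\ x <= c <= y).
  have bc := gap_right_le x1 Cc xc; have ca := le_gap_left y0 Cc cy.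
  have ax := gap_left_le x0; have xb := le_gap_right x1.
  have ay := gap_left_le y0; have yb := le_gap_right y1.
  rewrite /gap_fold ler_norml.
  have [[]|[]|[]] := zigzagP x (le_trans ax xb);
  have [[]|[]|[]] := zigzagP y (le_trans ay yb); lra.
have -> : gap_fold x = zigzag (gap_left y) (gap_right y) x.
  have -> : gap_left y = gap_left x.
    congr sup; apply/seteqP; split=> c /= -[Cc cx]; split=> //.
      by rewrite leNgt; apply/negP => xc; apply: noC; exists c; rewrite cx ltW.
    exact: le_trans xy.
  have -> // : gap_right y = gap_right x.
    congr inf; apply/seteqP; split=> c /= -[Cc cx]; split=> //.
      exact: le_trans cx.
    by rewrite leNgt; apply/negP => cy; apply: noC; exists c; rewrite cx ltW.
have ab := le_trans (gap_left_le y0) (le_gap_right y1).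
rewrite /gap_fold; move: (gap_left y) (gap_right y) ab => a b ab.
rewrite ler_norml.
have [[]|[]|[]] := zigzagP x ab; have [[]|[]|[]] := zigzagP y ab; lra.
Qed.

(* The outer two of the three laps over a gap give the two preimages. *)
Lemma gap_fold_preimages y : 0 <= y <= 1 -> ~ C y -> exists x x',
  [/\ x < x', 0 <= x <= 1 /\ 0 <= x' <= 1, ~ C x /\ ~ C x',
      gap_fold x = y & gap_fold x' = y].
Proof.
move=> /andP[y0 y1] nCy.
have ly : gap_left y < y.
  rewrite lt_neqAle gap_left_le// andbT; apply/eqP => e.
  by apply: nCy; rewrite -e; exact: gap_left_in.
have yr : y < gap_right y.
  rewrite lt_neqAle le_gap_right// andbT; apply/eqP => e.
  by apply: nCy; rewrite e; exact: gap_right_in.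
have l0 : 0 <= gap_left y by exact: le_gap_left.
have r1 : gap_right y <= 1 by exact: gap_right_le.
have inC c : C c -> c <= gap_left y \/ gap_right y <= c.
  move=> Cc; have [cy|yc] := leP c y; first by left; exact: le_gap_left.
  by right; apply: gap_right_le => //; exact: ltW.
have same x : gap_left y < x < gap_right y ->
    [/\ ~ C x, gap_left x = gap_left y & gap_right x = gap_right y].
  move=> /andP[lx xr]; split.
  - by move=> /inC[]; lra.
  - by congr sup; apply/seteqP; split=> c /= -[Cc cx]; split=> //;
      case: (inC _ Cc); lra.
  - by congr inf; apply/seteqP; split=> c /= -[Cc cx]; split=> //;
      case: (inC _ Cc); lra.
have [|nx lx rx] := same ((y + 2 * gap_left y) / 3); first by lra.
have [|nx' lx' rx'] := same ((y + 2 * gap_right y) / 3); first by lra.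
exists ((y + 2 * gap_left y) / 3), ((y + 2 * gap_right y) / 3).
split; [lra|split; lra|by []| |].
- by rewrite /gap_fold lx rx; have [[]|[]|[]] :=
    zigzagP ((y + 2 * gap_left y) / 3) (ltW (lt_trans ly yr)); lra.
- by rewrite /gap_fold lx' rx'; have [[]|[]|[]] :=
    zigzagP ((y + 2 * gap_right y) / 3) (ltW (lt_trans ly yr)); lra.
Qed.

Lemma iter_gap_fold_itv c d k x : 0 <= c -> d <= 1 -> C c -> C d ->
  c <= x <= d -> c <= iter k gap_fold x <= d.
Proof.
move=> c0 d1 Cc Cd cxd; elim: k => //= k IH.
by apply: gap_fold_itv => //; lra.
Qed.

Lemma iter_gap_fold_fix k x : 0 <= x <= 1 -> C x -> iter k gap_fold x = x.
Proof. by move=> x01 Cx; elim: k => //= k ->; exact: gap_fold_fix. Qed.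

Lemma iter_gap_fold_lipschitz k x y : 0 <= x <= 1 -> 0 <= y <= 1 ->
  `|iter k gap_fold x - iter k gap_fold y| <= 3 ^+ k * `|x - y|.
Proof.
move=> x01 y01; elim: k => [|k IH] /=; first by rewrite expr0 mul1r.
rewrite exprS -mulrA; apply: (le_trans (gap_fold_lipschitz _ _)).
- exact: iter_gap_fold_itv.
- exact: iter_gap_fold_itv.
- by rewrite ler_pM2l.
Qed.

(** Each step pulls the whole list back by the left preimage [u] and adds the right preimage [u'] of
    its head. The added point is new: equal to some [u z], it would have image [z], forcing [z] to
    be the head, whose two preimages differ. *)
Lemma iter_gap_fold_preimages k y : 0 <= y <= 1 -> ~ C y ->
  exists s : seq R, [/\ size s = k.+1, uniq s &
    forall x, x \in s -> [/\ 0 <= x <= 1, ~ C x & iter k gap_fold x = y]].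
Proof.
move=> y01 nCy; elim: k => [|k [s [sz us sP]]].
  by exists [:: y]; split=> // x; rewrite inE => /eqP ->.
have [u [u' uP]] : exists u u' : R -> R, forall z, 0 <= z <= 1 -> ~ C z ->
    [/\ u z < u' z, 0 <= u z <= 1 /\ 0 <= u' z <= 1, ~ C (u z) /\ ~ C (u' z),
      gap_fold (u z) = z & gap_fold (u' z) = z].
  have /choice[v vP] : forall z, exists v : R * R, 0 <= z <= 1 -> ~ C z ->
    [/\ v.1 < v.2, 0 <= v.1 <= 1 /\ 0 <= v.2 <= 1, ~ C v.1 /\ ~ C v.2,
      gap_fold v.1 = z & gap_fold v.2 = z].
    move=> z; have [[z01 nCz]|h] := pselect (0 <= z <= 1 /\ ~ C z).
      by have [x [x' P]] := gap_fold_preimages z01 nCz; exists (x, x').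
    (* A dummy value off the domain makes the chosen functions total. *)
    by exists (0, 0) => z01 nCz; case: h.
  by exists (fun z => (v z).1), (fun z => (v z).2).
have hs : head 0 s \in s by case: s sz {us sP} => // z s _; rewrite inE eqxx.
exists (u' (head 0 s) :: map u s); split.
- by rewrite /= size_map sz.
- rewrite /=; apply/andP; split.
    apply/mapP => -[z zs e]; have [h1 h2 h3] := sP _ hs.
    have [z1 z2 z3] := sP _ zs.
    have [A1 A2 _ A4 A5] := uP _ h1 h2; have [_ _ _ B4 B5] := uP _ z1 z2.
    by move: A5 A1; rewrite e B4 => <-; rewrite ltxx.
  rewrite map_inj_in_uniq// => a b /sP[a1 a2 _] /sP[b1 b2 _] e.
  have [_ _ _ <- _] := uP _ a1 a2; have [_ _ _ <- _] := uP _ b1 b2.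
  by rewrite e.
- move=> x; rewrite inE => /predU1P[->|/mapP[z zs ->]].
    have [h1 h2 h3] := sP _ hs; have [A1 [? ?] [? ?] A4 A5] := uP _ h1 h2.
    by split=> //; rewrite iterSr A5.
  have [h1 h2 h3] := sP _ zs; have [A1 [? ?] [? ?] A4 A5] := uP _ h1 h2.
  by split=> //; rewrite iterSr A4.
Qed.

End GapFold.

(** * Covers by sets that are small for the Bowen distances *)

Section BowenCovers.
Context {R : realType} (F : R -> R) (eps : R).

(* [A] is covered by [k] sets, the fibres of a code, each of diameter less than
   [eps] for the n-th Bowen distance. *)
Definition bowen_coverable (n : nat) (A : set R) (k : nat) :=
  exists (T : finType) (c : R -> T), (#|T| <= k)%N /\
    forall x y, A x -> A y -> c x = c y ->
      forall i, (i < n)%N -> `|iter i F x - iter i F y| < eps.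

Lemma bowen_coverable0 A : bowen_coverable 0 A 1.
Proof. by exists unit, (fun=> tt); rewrite card_unit. Qed.

Lemma bowen_coverable_sub n A B k : A `<=` B ->
  bowen_coverable n B k -> bowen_coverable n A k.
Proof.
move=> AB [T [c [Tk cP]]]; exists T, c; split=> // x y /AB Bx /AB By.
exact: cP.
Qed.

Lemma bowen_coverable_setU n A B k l : bowen_coverable n A k ->
  bowen_coverable n B l -> bowen_coverable n (A `|` B) (k + l).
Proof.
move=> [T [c [Tk cP]]] [U [d [Ul dP]]].
exists (T + U)%type, (fun x => if pselect (A x) then inl (c x) else inr (d x)).
split; first by rewrite card_sum leq_add.
move=> x y ABx ABy.
case: pselect => Ax; case: pselect => Ay // -[] e; first exact: cP.
by apply: dP => //; [case: ABx|case: ABy].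
Qed.

(** The code of [F x] serves for [x]: it controls all times from 1 on, and the smallness of [A]
    controls time 0. *)
Lemma bowen_coverableS n A B k : (forall x, A x -> B (F x)) ->
  (forall x y, A x -> A y -> `|x - y| < eps) ->
  bowen_coverable n B k -> bowen_coverable n.+1 A k.
Proof.
move=> AB dA [T [c [Tk cP]]]; exists T, (c \o F); split=> //.
move=> x y Ax Ay e [_|i]; first exact: dA.
by rewrite ltnS !iterSr; apply: cP => //; exact: AB.
Qed.

Hypothesis eps0 : 0 < eps.

(** From time [N] on the orbits coincide, so only the first [N] times matter and [k] does not grow
    with [n]. *)
Lemma bowen_coverable_const N n A k :
  (forall x y, A x -> A y -> iter N F x = iter N F y) ->
  bowen_coverable N A k -> bowen_coverable n A k.
Proof.
move=> AN [T [c [Tk cP]]]; exists T, c; split=> // x y Ax Ay e i _.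
have [iN|Ni] := ltnP i N; first exact: cP.
by rewrite -(subnK Ni) !iterD (AN x y)// subrr normr0.
Qed.

(** A crude bound, meant for one fixed [n]: the code records the cell of width [1 / Q] containing
    each of the first [n] iterates. *)
Lemma bowen_coverable_unit n : (forall x : R, 0 <= x <= 1 -> 0 <= F x <= 1) ->
  exists k, bowen_coverable n [set x | 0 <= x <= 1] k.
Proof.
move=> F01; elim: n => [|n [k [T [c [Tk cP]]]]].
  by exists 1%N; exact: bowen_coverable0.
pose Q := (Num.truncn eps^-1).+1.
have Qe : Q%:R^-1 < eps.
  by rewrite invf_plt ?posrE ?ltr0n//; exact: truncnS_gt.
(* There are [Q.+1] cells because the point 1 gets index [Q]. *)
exists #|((T * 'I_Q.+1)%type : finType)|%N, (T * 'I_Q.+1)%type.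
exists (fun x => (c (F x), inord (Num.truncn (Q%:R * x)))).
split=> // x y /= x01 y01 [ec eQ] [_|i]; last first.
  by rewrite ltnS !iterSr; apply: cP => //=; exact: F01.
have tQ (z : R) : 0 <= z <= 1 -> (Num.truncn (Q%:R * z) < Q.+1)%N.
  move=> /andP[z0 z1]; rewrite ltnS truncn_le_nat.
  by rewrite (le_lt_trans (ler_piMr _ z1))// ltr_nat.
have et : Num.truncn (Q%:R * x) = Num.truncn (Q%:R * y).
  by have /(congr1 val) := eQ; rewrite /= !inordK ?tQ.
have Qx : 0 <= Q%:R * x by rewrite mulr_ge0//; lra.
have Qy : 0 <= Q%:R * y by rewrite mulr_ge0//; lra.
have := truncn_itv Qx; have := truncn_itv Qy; rewrite et.
set t := Num.truncn _; rewrite -natr1 => /andP[y1 y2] /andP[x1 x2].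
apply: lt_trans Qe; rewrite -(ltr_pM2l (_ : 0 < Q%:R))// divff ?pnatr_eq0//.
rewrite -[X in X * `|_|]ger0_norm// -normrM mulrBr ltr_norml /=; lra.
Qed.

End BowenCovers.

(** * The ternary Cantor set and its symbolic dynamics *)

Section TernaryCantor.
Context {R : realType}.
Local Notation I01 := [set x : R | 0 <= x <= 1].

Definition tent (x : R) : R := Num.min 1 (Num.min (3 * x) (3 - 3 * x)).

(** The classical middle-thirds set, described dynamically: the n-th condition removes the gaps
    created at stage n of the usual construction. *)
Definition ternary_cantor : set R :=
  [set x | 0 <= x <= 1 /\ forall n, ~ 1 / 3 < iter n tent x < 2 / 3].

(** The two inverse branches of [tent] off the middle third; the right one, [true], reverses
    orientation. *)
Definition branch (b : bool) (x : R) : R := if b then 1 - x / 3 else x / 3.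

Definition cylinder (w : seq bool) (x : R) : R := foldr branch x w.

Lemma tentP x : [\/ 3 * x <= 1 /\ tent x = 3 * x,
  1 <= 3 * x <= 2 /\ tent x = 1 | 2 <= 3 * x /\ tent x = 3 - 3 * x].
Proof.
rewrite /tent; case: (leP (3 * x) (3 - 3 * x)) => h.
  case: (leP 1 (3 * x)) => h'; last by constructor 1; split; lra.
  by constructor 2; split; lra.
case: (leP 1 (3 - 3 * x)) => h'; last by constructor 3; split; lra.
by constructor 2; split; lra.
Qed.

Lemma tent_itv x : 0 <= x <= 1 -> 0 <= tent x <= 1.
Proof. by move=> x01; have [[]|[]|[]] := tentP x; lra. Qed.

Lemma tent_lipschitz x y : `|tent x - tent y| <= 3 * `|x - y|.
Proof.
wlog xy : x y / x <= y.
  move=> h; have [xy|yx] := leP x y; first exact: h.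
  by rewrite distrC (distrC x); apply: h => //; exact: ltW.
have -> : `|x - y| = y - x by rewrite distrC ger0_norm// subr_ge0.
rewrite ler_norml.
by have [[]|[]|[]] := tentP x; have [[]|[]|[]] := tentP y; lra.
Qed.

Lemma branch_itv b x : 0 <= x <= 1 -> 0 <= branch b x <= 1.
Proof. by case: b => /=; lra. Qed.

Lemma tent_branch b x : 0 <= x <= 1 -> tent (branch b x) = x.
Proof.
by move=> x01; have [[]|[]|[]] := tentP (branch b x); case: b => /=; lra.
Qed.

Lemma tent_mid x : 1 / 3 <= x <= 2 / 3 -> tent x = 1.
Proof. by move=> hx; have [[]|[]|[]] := tentP x; lra. Qed.

Lemma ternary_cantor_branch b x :
  ternary_cantor x -> ternary_cantor (branch b x).
Proof.
move=> [x01 xn]; split; first exact: branch_itv.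
case=> [|n]; first by case: b => /=; lra.
by rewrite iterSr tent_branch.
Qed.

Lemma ternary_cantor0 : ternary_cantor 0.
Proof.
split; first by lra.
have t0 : tent 0 = 0 by have [[]|[]|[]] := tentP 0; lra.
have it n : iter n tent 0 = 0 by elim: n => //= n ->.
by move=> n; rewrite it; lra.
Qed.

Lemma ternary_cantor1 : ternary_cantor 1.
Proof.
by have := ternary_cantor_branch true ternary_cantor0; rewrite /= mul0r subr0.
Qed.

Lemma closed_ternary_cantor : closed ternary_cantor.
Proof.
have -> : ternary_cantor = `[0, 1]%classic `&`
    \bigcap_n (iter n tent @^-1` (~` `]1 / 3, 2 / 3[%classic)).
  apply/seteqP; split=> x /=; rewrite in_itv/=.
    by move=> [x01 xn]; split=> // n _ /=; rewrite in_itv/=; exact: xn.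
  by move=> [x01 xn]; split=> // n; have := xn n I; rewrite /= in_itv/=.
apply: closedI; first exact: itv_closed.
apply: closed_bigI => n _; apply: preimage_closed; last first.
  by apply: open_closedC; exact: itv_open.
move=> x _; elim: n => [|n IH]; first exact: cvg_id.
apply: (continuous_comp IH); apply: continuous_min; first exact: cvg_cst.
apply: continuous_min; first exact: mulrl_continuous.
by apply: cvgB; [exact: cvg_cst|exact: mulrl_continuous].
Qed.

(** A point of the open middle third is off the set already. Any other point is [branch b z], and an
    approximation of [z] is carried over by the same branch, which divides the error by 3. *)
Lemma ternary_cantor_codense n x : 0 <= x <= 1 -> exists y,
  [/\ 0 <= y <= 1, ~ ternary_cantor y & `|x - y| <= 3^-1 ^+ n].
Proof.
elim: n x => [|n IH] x x01.
  exists (1 / 2); split; [lra| |by rewrite expr0 ler_norml; lra].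
  by move=> [_ /(_ 0%N)] /=; lra.
have [xm|xm] := pselect (1 / 3 < x < 2 / 3).
  exists x; split=> //; first by move=> [_ /(_ 0%N)].
  by rewrite subrr normr0 exprn_ge0// invr_ge0.
have [b [z [z01 xz]]] : exists b z, 0 <= z <= 1 /\ x = branch b z.
  have [x3|x3] := leP x (1 / 3).
    by exists false, (3 * x); split; rewrite /=; lra.
  by exists true, (3 - 3 * x); split; rewrite /=; lra.
have [y [y01 Cy zy]] := IH z z01.
exists (branch b y); split; first exact: branch_itv.
  move=> [_ yn]; apply: Cy; split=> // k.
  by have := yn k.+1; rewrite iterSr tent_branch.
rewrite xz exprS; move: zy; rewrite !ler_norml; case: b {xz} => /=; lra.
Qed.

Lemma cylinder_itv w x : 0 <= x <= 1 -> 0 <= cylinder w x <= 1.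
Proof. by move=> x01; elim: w => //= b w; exact: branch_itv. Qed.

Lemma ternary_cantor_cylinder w x :
  ternary_cantor x -> ternary_cantor (cylinder w x).
Proof. by move=> Cx; elim: w => //= b w; exact: ternary_cantor_branch. Qed.

Lemma cylinder_affine w : exists p q, q != 0 /\
  forall x, cylinder w x = p + q * x.
Proof.
elim: w => [|b w [p [q [q0 pq]]]]; first by exists 0, 1; split => // x /=; lra.
exists (branch b p), ((if b then -1 else 1) * q / 3); split.
  by rewrite !mulf_neq0// ?invr_neq0//; case: b.
by move=> x /=; rewrite pq /branch; case: b; lra.
Qed.

Lemma cylinder_dist w x y :
  `|cylinder w x - cylinder w y| = 3^-1 ^+ size w * `|x - y|.
Proof.
elim: w => [|b w IH] /=; first by rewrite expr0 mul1r.
rewrite exprS -mulrA -IH -[X in X * _](@ger0_norm _ (3^-1 : R)) ?invr_ge0//.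
rewrite -normrM mulrBr; case: b => /=; last by rewrite ![_ / 3]mulrC.
by rewrite distrC; congr `|_|; lra.
Qed.

Lemma cylinder_iter_tent k w x : 0 <= x <= 1 -> (k <= size w)%N ->
  iter k tent (cylinder w x) = cylinder (drop k w) x.
Proof.
move=> x01; elim: k w => [|k IH] [|b w]//= kw.
by rewrite -iterS iterSr tent_branch ?cylinder_itv// IH.
Qed.

Definition cylinder_set (w : seq bool) (A : set R) : set R := cylinder w @` A.

Lemma cylinder_cat w w' (x : R) :
  cylinder (w ++ w') x = cylinder w (cylinder w' x).
Proof. exact: foldr_cat. Qed.

(** Two cases arise because an odd number of letters [true] in [w] reverses the order. *)
Lemma cylinder_between w (u v x : R) :
  u <= x <= v -> cylinder w u <= cylinder w x <= cylinder w v \/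
                 cylinder w v <= cylinder w x <= cylinder w u.
Proof.
move=> /andP[ux xv]; have [p [q [_ E]]] := @cylinder_affine w.
rewrite !E !lerD2l; have [q0|q0] := leP 0 q.
  by left; rewrite !ler_wpM2l.
by right; rewrite !ler_wnM2l// ltW.
Qed.

Lemma cylinder_betweenP w (u v y : R) :
  cylinder w u <= y <= cylinder w v \/ cylinder w v <= y <= cylinder w u ->
  u <= v -> cylinder_set w [set x | u <= x <= v] y.
Proof.
have [p [q [q0 E]]] := @cylinder_affine w.
rewrite !E => h uv; exists ((y - p) / q); last first.
  by rewrite E mulrC divfK// addrC subrK.
move: q0 => /=; rewrite neq_lt => /orP[q0|q0].
  by rewrite ler_ndivlMr// ler_ndivrMr//; move: h; nra.
by rewrite ler_pdivlMr// ler_pdivrMr//; move: h; nra.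
Qed.

(** Compactness: the cylinders of the prefixes of [b] are nested closed intervals, and the supremum
    of their lower ends [l n] lies in all of them. *)
Lemma nested_cylinders (b : nat -> bool) : exists x,
  forall n, cylinder_set (mkseq b n) I01 x.
Proof.
pose w := mkseq b.
pose l n := Num.min (cylinder (w n) 0) (cylinder (w n) 1 : R).
pose r n := Num.max (cylinder (w n) 0) (cylinder (w n) 1 : R).
have between n x : I01 x -> l n <= cylinder (w n) x <= r n.
  move=> /(@cylinder_between (w n)); rewrite /l /r.
  by case: (leP (cylinder (w n) 0) (cylinder (w n) 1)) => ? []; lra.
have wS n : w n.+1 = w n ++ [:: b n] by rewrite /w /mkseq -addn1 iotaD map_cat.
have step n : l n <= l n.+1 /\ r n.+1 <= r n.
  have c0 : I01 (@cylinder [:: b n] 0) by apply: cylinder_itv; lra.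
  have c1 : I01 (@cylinder [:: b n] 1) by apply: cylinder_itv; lra.
  have := between n _ c0; have := between n _ c1.
  rewrite -!cylinder_cat -wS /= => /andP[? ?] /andP[? ?].
  by rewrite le_min ge_max; split; apply/andP.
have lr k n : l k <= r n.
  have /nondecreasing_seqP lm i : l i <= l i.+1 by case: (step i).
  have /nonincreasing_seqP rm i : r i.+1 <= r i by case: (step i).
  apply: le_trans (lm _ _ (leq_maxl k n)) _.
  apply: le_trans (rm _ _ (leq_maxr k n)).
  have /(between (maxn k n))/andP[] : I01 0 by rewrite /=; lra.
  exact: le_trans.
exists (sup (range l)) => n; apply: cylinder_betweenP; last by [].
have -> : mkseq b n = w n by [].
have : l n <= sup (range l).
  by apply: ub_le_sup; [exists (r 0%N) => _ [k _ <-]|exists n].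
have : sup (range l) <= r n.
  by apply: ge_sup; [exists (l n), n|move=> _ [k _ <-]].
rewrite /l /r; case: (leP (cylinder (w n) 0) (cylinder (w n) 1)) => ? ? ?.
  by left; lra.
by right; lra.
Qed.

Lemma branch_side b (x : R) :
  0 <= x <= 1 -> ~ 1 / 3 < branch b x < 2 / 3 /\ (branch b x > 1 / 2) = b.
Proof.
move=> x01; case: b => /=; split.
- by lra.
- by apply/idP; lra.
- by lra.
- by apply/negbTE; rewrite -leNgt; lra.
Qed.

Lemma itinerary_surj (b : nat -> bool) : exists x, ternary_cantor x /\
  forall n, (1 / 2 < iter n tent x) = b n.
Proof.
have [x xb] := nested_cylinders b; exists x.
have it n : exists y, I01 y /\ iter n tent x = branch (b n) y.
  have [y y01 <-] := xb n.+1; exists y; split=> //.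
  rewrite cylinder_iter_tent ?size_mkseq//.
  by rewrite /mkseq -addn1 iotaD map_cat drop_size_cat ?size_map ?size_iota.
have x01 : I01 x by have [y y01 <-] := xb 0%N.
split; last first.
  by move=> n; have [y [y01 ->]] := it n; case: (branch_side (b n) y01).
by split=> // n; have [y [y01 ->]] := it n; case: (branch_side (b n) y01).
Qed.

Lemma uncountable_ternary_cantor : ~ countable ternary_cantor.
Proof.
move=> /countable_injP[e einj].
(* Cantor's diagonal argument: digit [n] is the opposite of the n-th digit of the point numbered [n]
   by [e], so [x] would differ from itself at digit [e x]. *)
have [x [Cx xb]] := itinerary_surj (fun n =>
  `[< exists y, [/\ ternary_cantor y, e y = n & ~ 1 / 2 < iter n tent y] >]).
have := xb (e x); case: asboolP.
  move=> [y [Cy eyx h]] xh; apply: h.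
  by rewrite (einj y x)// ?inE//; rewrite xh.
by move=> h /negbT xh; apply: h; exists x; split=> //; exact/negP.
Qed.

End TernaryCantor.

(** * The folded tent map: cylinders, covers, separation and preimages *)

Section FoldedTent.
Context {R : realType} (m : nat).
Local Notation C := (@ternary_cantor R).
Local Notation I01 := [set x : R | 0 <= x <= 1].

Definition folded_tent (x : R) : R := iter m (gap_fold C) (tent x).

Local Notation F := folded_tent.

Let clC := @closed_ternary_cantor R.
Let C0 := @ternary_cantor0 R.
Let C1 := @ternary_cantor1 R.

Lemma folded_tent_itv (x : R) : 0 <= x <= 1 -> 0 <= F x <= 1.
Proof. by move=> /tent_itv x01; apply: iter_gap_fold_itv. Qed.

Lemma folded_tent_lipschitz (x y : R) : 0 <= x <= 1 -> 0 <= y <= 1 ->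
  `|F x - F y| <= 3 ^+ m.+1 * `|x - y|.
Proof.
move=> /tent_itv x01 /tent_itv y01.
apply: (le_trans (iter_gap_fold_lipschitz C0 C1 m x01 y01)).
by rewrite exprSr -mulrA ler_wpM2l ?exprn_ge0// tent_lipschitz.
Qed.

Lemma folded_tent_branch b (x : R) :
  0 <= x <= 1 -> F (branch b x) = iter m (gap_fold C) x.
Proof. by move=> x01; rewrite /F tent_branch. Qed.

Lemma folded_tent_mid (x : R) : 1 / 3 <= x <= 2 / 3 -> F x = 1.
Proof.
by move=> xm; rewrite /F tent_mid// iter_gap_fold_fix//; lra.
Qed.

(** The tent map drops the letter [b], and the folding cannot leave an interval with endpoints in
    [C]. The endpoints 0, 1 give full cylinders; 1/3, 2/3 give gaps. *)
Lemma folded_tent_cylinder b w (u v x : R) : C u -> C v -> u <= x <= v ->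
  cylinder_set w [set x | u <= x <= v] (F (cylinder (b :: w) x)).
Proof.
move=> Cu Cv uxv; have [u01 _] := Cu; have [v01 _] := Cv.
have x01 : 0 <= x <= 1 by lra.
have uv : u <= v by lra.
rewrite /= folded_tent_branch; last exact: cylinder_itv.
have [Du Dv] := (ternary_cantor_cylinder w Cu, ternary_cantor_cylinder w Cv).
have /andP[u0 u1] := cylinder_itv w u01.
have /andP[v0 v1] := cylinder_itv w v01.
apply: cylinder_betweenP => //.
by have [h|h] := cylinder_between w uxv; [left|right];
  apply: iter_gap_fold_itv.
Qed.

Let C13 : C (1 / 3).
Proof. by have := ternary_cantor_branch false C1. Qed.

Let C23 : C (2 / 3).
Proof.
by have := ternary_cantor_branch true C1; rewrite /=; congr C; lra.
Qed.

Definition gap (w : seq bool) : set R :=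
  cylinder_set w [set x | 1 / 3 <= x <= 2 / 3].

(** Each step drops one letter until the gap becomes the middle third, which the next step collapses
    to 1. *)
Lemma iter_folded_tent_gap w (x : R) : gap w x -> iter (size w).+1 F x = 1.
Proof.
elim: w x => [|b w IH] x [z zm <-]; first exact: folded_tent_mid.
rewrite iterSr; apply: IH; exact: folded_tent_cylinder.
Qed.

Lemma cylinder_set_split w : cylinder_set w I01 `<=`
  cylinder_set (rcons w false) I01 `|`
    (gap w `|` cylinder_set (rcons w true) I01).
Proof.
move=> _ [x /= x01 <-]; rewrite -!cats1.
have [x3|x3] := leP x (1 / 3).
  left; exists (3 * x); rewrite ?cylinder_cat /=; first by lra.
  by congr cylinder; lra.
have [x32|x32] := leP x (2 / 3); first by right; left; exists x => //=; lra.
right; right; exists (3 - 3 * x); rewrite ?cylinder_cat /=; first by lra.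
by congr cylinder; lra.
Qed.

Lemma folded_tent_coverable (eps : R) : 0 < eps ->
  exists K, forall n, bowen_coverable F eps n I01 (2 ^ n * K).
Proof.
move=> eps0; have [N Ne] := exists_expr_third_lt eps0.
have small w x y : (N <= size w)%N -> cylinder_set w I01 x ->
    cylinder_set w I01 y -> `|x - y| < eps.
  move=> Nw [z z01 <-] [z' z'01 <-]; rewrite cylinder_dist.
  apply: le_lt_trans Ne; apply: (@le_trans _ _ (3^-1 ^+ size w)).
    rewrite ler_piMr// ?exprn_ge0// ler_norml.
    by move: z01 z'01 => /=; lra.
  by rewrite ler_wiXn2l//; lra.
(* Time [N.+1] suffices for [D]: by then every gap of rank at most [N] has become a point. *)
have [D DP] := bowen_coverable_unit eps0 N.+1 folded_tent_itv.
have gapD n w : (size w <= N)%N -> bowen_coverable F eps n (gap w) D.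
  move=> wN; apply: (@bowen_coverable_const _ _ _ eps0 N.+1).
    move=> x y gx gy; rewrite -(subnK wN) -addnS !iterD.
    by rewrite !iter_folded_tent_gap.
  apply: bowen_coverable_sub DP => _ [z /= z3 <-].
  by apply: cylinder_itv; lra.
have split n w k l : (size w <= N)%N ->
    bowen_coverable F eps n (cylinder_set (rcons w false) I01) k ->
    bowen_coverable F eps n (cylinder_set (rcons w true) I01) l ->
    bowen_coverable F eps n (cylinder_set w I01) (k + (D + l)).
  move=> wN hk hl; apply: (bowen_coverable_sub (@cylinder_set_split w)).
  by do 2?[apply: bowen_coverable_setU] => //; exact: gapD.
(* The recursion sends [k] to [2 k + D], so [k + D] exactly doubles; it is the quantity to bound. *)
have rankN n : exists k, (k + D <= 2 ^ n * D.+1)%N /\ forall w, size w = N ->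
    bowen_coverable F eps n (cylinder_set w I01) k.
  elim: n => [|n [k [kD IH]]].
    by exists 1%N; split; [lia|move=> w _; exact: bowen_coverable0].
  exists (k + (D + k))%N; split; first by rewrite expnS; lia.
  (* A cylinder of rank [N.+1] is smaller than [eps] and is mapped into one of rank [N], so it
     inherits the count for time [n]. *)
  have child w c : size w = N ->
      bowen_coverable F eps n.+1 (cylinder_set (rcons w c) I01) k.
    move=> wN; case E: (rcons w c) => [|b w']; first by case: w {wN} E.
    have Nw' : size w' = N.
      by have := congr1 size E; rewrite size_rcons wN => -[].
    apply: (@bowen_coverableS _ _ _ _ _ (cylinder_set w' I01)); last exact: IH.
      by move=> _ [z z01 <-]; exact: folded_tent_cylinder.
    by move=> x y; apply: small; rewrite /= Nw'.
  by move=> w wN; apply: split; [rewrite wN|exact: child|exact: child].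
exists (2 ^ N * D.+1)%N => n.
(* With [n] fixed, [N] further splittings lead from rank [N] to the whole interval, each doubling
   [k + D]. The induction is on [N - size w]. *)
have [k [kD kP]] : exists k, (k + D <= 2 ^ N * (2 ^ n * D.+1))%N /\
    forall w, (size w + N = N)%N ->
    bowen_coverable F eps n (cylinder_set w I01) k.
  have : (N <= N)%N by [].
  elim: {1 3 4}N => [_|j IH jN].
    have [k [kD kP]] := rankN n; exists k; split=> [|w]; first by rewrite mul1n.
    by rewrite addn0; exact: kP.
  have [k [kD kP]] := IH (ltnW jN).
  exists (k + (D + k))%N; split; first by rewrite expnS; lia.
  move=> w wN; apply: split; first by lia.
    by apply: kP; rewrite size_rcons; lia.
  by apply: kP; rewrite size_rcons; lia.
have [T [c [Tk cP]]] := kP [::] erefl.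
exists T, c; split; first by lia.
by move=> x y x01 y01; apply: cP; [exists x|exists y].
Qed.

(** The points [cylinder w 0] lie in [C], where folding is the identity, so [F] just drops letters.
    At the first differing letter one orbit is in the left third and the other in the right
    third. *)
Lemma folded_tent_separated w w' : size w = size w' -> w != w' ->
  exists2 i, (i < size w)%N &
    1 / 3 <= `|iter i F (cylinder w 0) - iter i F (cylinder w' 0)|.
Proof.
elim: w w' => [|b w IH] [|b' w']//= [ww'].
have c01 v : 0 <= @cylinder R v 0 <= 1 by apply: cylinder_itv; lra.
have FE b1 v : F (branch b1 (cylinder v 0)) = cylinder v 0.
  rewrite folded_tent_branch// iter_gap_fold_fix//.
  exact: ternary_cantor_cylinder.
have [->|bb'] := eqVneq b b'.
  rewrite eqseq_cons eqxx/= => /IH[//|i iw h].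
  by exists i.+1 => //; rewrite !iterSr !FE.
move=> _; exists 0%N => //=.
move: (c01 w) (c01 w') bb'; case: b; case: b' => //= h h' _.
  by rewrite ler_normr; apply/orP; left; lra.
by rewrite ler_normr; apply/orP; right; lra.
Qed.

(** The left branch of the tent map alone carries the [m.+1] preimages under the folding to
    preimages under [F]. *)
Lemma folded_tent_preimages k (y : R) : (k <= m.+1)%N -> 0 <= y <= 1 -> ~ C y ->
  exists s : seq R, [/\ size s = k, uniq s &
    forall x, x \in s -> 0 <= x <= 1 /\ F x = y].
Proof.
move=> km y01 nCy.
have [s [sz us sP]] := iter_gap_fold_preimages clC C0 C1 m y01 nCy.
exists (take k [seq x / 3 | x <- s]); split.
- by rewrite size_takel// size_map sz.
- by rewrite take_uniq// map_inj_uniq// => a b; lra.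
- move=> _ /mem_take/mapP[x /sP[x01 _ <-] ->]; split; first by lra.
  exact: (@folded_tent_branch false).
Qed.

(** The folding is onto, being the identity on [C], and the two branches supply two preimages of
    [z]. *)
Lemma folded_tent_twofold (y : R) : 0 <= y <= 1 ->
  exists s : seq R, [/\ size s = 2, uniq s &
    forall x, x \in s -> 0 <= x <= 1 /\ F x = y].
Proof.
move=> y01.
have [z [z01 zy]] : exists z, 0 <= z <= 1 /\ iter m (gap_fold C) z = y.
  have [Cy|nCy] := pselect (C y).
    by exists y; split=> //; exact: iter_gap_fold_fix.
  have [s [sz _ sP]] := iter_gap_fold_preimages clC C0 C1 m y01 nCy.
  case: s sz sP => // z s _ sP.
  by have [z01 _ zy] := sP z (mem_head _ _); exists z.
exists [:: branch false z; branch true z]; split=> //.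
  by rewrite /= inE andbT; apply/eqP; lra.
by move=> x; rewrite !inE => /orP[]/eqP->; split;
  rewrite ?branch_itv ?folded_tent_branch.
Qed.

End FoldedTent.

(** Turns a list of distinct preimages into the cardinal inequality of [kfold]. *)
Lemma card_II_le_seq {T : eqType} (A : set T) (s : seq T) :
  uniq s -> (forall x, x \in s -> A x) -> (`I_(size s) #<= A)%card.
Proof.
case: s => [|x0 s] us sA; first by rewrite II0 card_ge0.
pose h (i : nat) := nth x0 (x0 :: s) i.
have hinj : {in `I_(size (x0 :: s)) &, injective h}.
  move=> i j; rewrite !inE => /= iS jS e; apply/eqP.
  by rewrite -(@nth_uniq _ x0 (x0 :: s) i j iS jS us); apply/eqP.
rewrite -(card_le_eql (inj_card_eq hinj)); apply: subset_card_le.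
by move=> _ [i /= iS <-]; apply: sA; exact: mem_nth.
Qed.

(** * Entropy from two-sided bounds on separated sets *)

Section Entropy.
Context {R : realType} {X : pseudoMetricType R} (f : X -> X).

Lemma bowen_separated_le n (e e' : R) E : e <= e' ->
  bowen_separated f n e' E -> bowen_separated f n e E.
Proof.
move=> ee' sE x y xE yE xy; have [i iN h] := sE _ _ xE yE xy.
by exists i => // b; apply: h; exact: le_ball b.
Qed.

(** At every scale below [e0] the separation numbers lie between [2 ^ n] and a constant multiple of
    it. The growth rate is then [ln 2] at all these scales, hence so is its limit. *)
Lemma topological_entropy_eq_ln2 (e0 : R) : 0 < e0 ->
  (forall n, exists2 E, bowen_separated f n e0 E & #|` E| = (2 ^ n)%N) ->
  (forall e, 0 < e -> exists K, forall n E, bowen_separated f n e E ->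
    (#|` E| <= 2 ^ n * K)%N) ->
  topological_entropy f = (ln 2)%:E.
Proof.
move=> e00 lb ub; apply: lim_near_cst; first exact: ereal_hausdorff.
near=> e.
have e_gt0 : 0 < e by [].
have ee0 : e < e0 by near: e; exact: nbhs_right_lt.
have [K KP] := ub e e_gt0.
(* [K.+1] instead of [K] keeps the argument of the logarithm positive. *)
have sub n : (sep_number f n e <= (2 ^+ n * K.+1%:R)%:E)%E.
  apply: ge_ereal_sup => _ [E sE <-]; rewrite lee_fin -natrX -natrM ler_nat.
  by rewrite (leq_trans (KP _ _ sE))// leq_mul.
have slb n : ((2 ^+ n)%:E <= sep_number f n e)%E.
  have [E sE cE] := lb n; apply: ereal_sup_ubound; exists E.
    exact: bowen_separated_le (ltW ee0) sE.
  by rewrite cE natrX.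
apply: (cvg_limn_einf_sup _).2.
apply: (@squeeze_cvge _ _ _ _ (cst (ln 2)%:E) _
  (fun n => (ln 2 + ln K.+1%:R * n%:R^-1)%:E)).
- near=> n; have n0 : (0 < n)%N by near: n; exists 1%N.
  have nR : (n%:R : R) != 0 by rewrite pnatr_eq0 -lt0n.
  have p2 : 0 < 2 ^+ n :> R by rewrite exprn_gt0.
  have in0 (r : R) : 0 < r -> r%:E \in `[0, +oo]%E.
    by move=> r0; rewrite in_itv/= lee_fin ltW//= leey.
  have sin : sep_number f n e \in `[0, +oo]%E.
    by rewrite in_itv/= leey andbT (le_trans _ (slb n))// lee_fin ltW.
  have pK : 0 < 2 ^+ n * K.+1%:R :> R by rewrite mulr_gt0.
  apply/andP; split.
    rewrite /= (_ : (ln 2)%:E = (n%:R^-1)%:E * lne (2 ^+ n)%:E)%E; last first.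
      by rewrite lne_EFin// lnXn// -EFinM -[ln 2 *+ n]mulr_natl mulKf.
    by rewrite lee_wpmul2l ?lee_fin ?invr_ge0// lee_lne// in0.
  rewrite (_ : (_ + _)%:E =
    (n%:R^-1)%:E * lne (2 ^+ n * K.+1%:R)%:E)%E; last first.
    rewrite lne_EFin// lnM ?posrE// lnXn// -EFinM; congr _%:E.
    by rewrite mulrDr -[ln 2 *+ n]mulr_natl mulKf// mulrC.
  by rewrite lee_wpmul2l ?lee_fin ?invr_ge0// lee_lne// in0.
- exact: cvg_cst.
- apply: cvg_EFin; first by apply: nearW.
  rewrite -[X in _ --> X](addr0 (ln 2 : R)).
  apply: cvgD; first exact: cvg_cst.
  rewrite -(mulr0 (ln K.+1%:R)); apply: cvgMl_tmp.
  apply/gtr0_cvgV0; last exact: cvgr_idn.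
  by near=> n; rewrite ltr0n; near: n; exists 1%N.
Unshelve. all: by end_near. Qed.

End Entropy.

(** * Transfer from the real line to the interval as a subtype *)

Lemma unit_interval_itv {R : realType} (u : unit_interval R) : 0 <= val u <= 1.
Proof. by have := set_mem (valP u); rewrite /= in_itv. Qed.

Lemma unit_interval_ballE {R : realType} (u v : unit_interval R) (e : R) :
  ball u e v = (`|val u - val v| < e) :> Prop.
Proof. by []. Qed.

Lemma unit_interval_ex {R : realType} (x : R) : 0 <= x <= 1 ->
  exists u : unit_interval R, val u = x.
Proof.
move=> x01; have h : x \in `[(0 : R), 1]%classic by rewrite inE /= in_itv.
by exists (SigSub h).
Qed.

Section Restriction.
Context {R : realType} (F : R -> R) (f : unit_interval R -> unit_interval R).
Hypothesis fF : forall u, val (f u) = F (val u).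

Lemma val_iter_restriction n u : val (iter n f u) = iter n F (val u).
Proof. by elim: n => // n IH; rewrite !iterS fF IH. Qed.

Lemma restriction_continuous (k : R) :
  (forall x y, 0 <= x <= 1 -> 0 <= y <= 1 -> `|F x - F y| <= k * `|x - y|) ->
  continuous f.
Proof.
move=> Fk u A /nbhs_ballP[e /= e0 eA]; apply/nbhs_ballP.
(* The added 1 makes the divisor positive whatever [k] is. *)
have k0 : 0 < `|k| + 1 by rewrite ltr_wpDl.
exists (e / (`|k| + 1)) => /=; first exact: divr_gt0.
move=> v uv; apply: eA; rewrite unit_interval_ballE !fF.
apply: le_lt_trans (Fk _ _ (unit_interval_itv u) (unit_interval_itv v)) _.
move: uv; rewrite unit_interval_ballE ltr_pdivlMr// mulrC; apply: le_lt_trans.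
by rewrite ler_wpM2r// (le_trans (ler_norm _))// lerDl.
Qed.

Lemma restriction_preimages k y (s : seq R) : size s = k -> uniq s ->
  (forall x, x \in s -> 0 <= x <= 1 /\ F x = val y) ->
  (`I_k #<= f @^-1` [set y])%card.
Proof.
move=> <- us sP.
have /choice[g gP] : forall x, exists u : unit_interval R,
    0 <= x <= 1 -> val u = x.
  move=> x; have [/unit_interval_ex[u ux]|h] := pselect (0 <= x <= 1).
    by exists u.
  have [u0 _] := @unit_interval_ex R 0 ltac:(lra).
  by exists u0.
rewrite -(size_map g); apply: card_II_le_seq.
  rewrite map_inj_in_uniq// => a b /sP[a01 _] /sP[b01 _] e.
  by rewrite -(gP a a01) -(gP b b01) e.
move=> _ /mapP[x /sP[x01 Fx] ->] /=; apply: val_inj.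
by rewrite fF gP.
Qed.

(** Pigeonhole: two points of [E] with equal codes would stay closer than [eps] up to time [n], so
    the code is injective on [E]. *)
Lemma restriction_separated n eps k (E : {fset unit_interval R}) :
  bowen_coverable F eps n [set x | 0 <= x <= 1] k ->
  bowen_separated f n eps E -> (#|` E| <= k)%N.
Proof.
move=> [T [c [Tk cP]]] sE; apply: leq_trans Tk.
rewrite cardfE; apply: (@leq_card _ _ (fun u : E => c (val (val u)))).
move=> u v e; apply: contrapT => /eqP uv.
have [i iN] := sE _ _ (valP u) (valP v) uv; apply.
rewrite unit_interval_ballE !val_iter_restriction.
by apply: cP => //=; exact: unit_interval_itv.
Qed.

End Restriction.

Theorem proposition1p2 (R : realType) (m : nat) (hm : (0 < m)%N) :
  exists f : unit_interval R -> unit_interval R,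
    [/\ continuous f,
        kfold f 2 setT,
        exists K : set (unit_interval R),
          [/\ nowhere_dense K, closed K, ~ countable K & kfold f m (~` K)] &
        topological_entropy f = (ln 2)%:E].
Proof.
have /choice[f fF] : forall u : unit_interval R, exists v : unit_interval R,
    val v = folded_tent m (val u).
  by move=> u; apply/unit_interval_ex/folded_tent_itv/unit_interval_itv.
pose K : set (unit_interval R) := val @^-1` @ternary_cantor R.
have clK : closed K.
  apply: preimage_closed; last exact: closed_ternary_cantor.
  by move=> u _; exact: initial_continuous.
exists f; split.
- exact: restriction_continuous fF _ (@folded_tent_lipschitz R m).
- move=> y _.
  have [s [sz us sP]] := folded_tent_twofold m (unit_interval_itv y).
  exact: (restriction_preimages fF sz us sP).
- exists K; split=> //.
  (* [K] is its own closure, and every ball contains a point off the Cantor set. *)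
  + rewrite /nowhere_dense -(closure_id _).1//; apply/seteqP; split=> // u.
    move=> /nbhs_ballP[e /= e0 eK].
    have [n ne] := exists_expr_third_lt e0.
    have [y [y01 nCy uy]] := ternary_cantor_codense n (unit_interval_itv u).
    have [v vy] := unit_interval_ex y01; apply: nCy; rewrite -vy; apply: eK.
    by rewrite unit_interval_ballE vy; exact: le_lt_trans ne.
  + move=> cK; apply: (@uncountable_ternary_cantor R).
    have -> : @ternary_cantor R = val @` K; last first.
      exact: card_le_trans (card_image_le _ _) cK.
    apply/seteqP; split=> [x Cx|_ [u Ku <-]//].
    by have [v vx] := unit_interval_ex Cx.1; exists v => //; rewrite /K /= vx.
  + move=> y nKy; have [s [sz us sP]] :=
      folded_tent_preimages (leqnSn m) (unit_interval_itv y) nKy.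
    exact: (restriction_preimages fF sz us sP).
- apply: (@topological_entropy_eq_ln2 _ _ _ (1 / 3)); first by lra.
    move=> n; have c01 (w : n.-tuple bool) : 0 <= @cylinder R w 0 <= 1.
      by apply: cylinder_itv; lra.
    have /choice[p pP] (w : n.-tuple bool) : exists u : unit_interval R,
      val u = cylinder w 0 by exact: unit_interval_ex.
    have sep (w w' : n.-tuple bool) : w != w' ->
        exists2 i, (i < n)%N &
          ~ ball (iter i f (p w)) (1 / 3) (iter i f (p w')).
      move=> ww'; have [] := @folded_tent_separated R m w w'.
      - by rewrite !size_tuple.
      - by rewrite val_eqE.
      move=> i; rewrite size_tuple => iN h; exists i => //.
      rewrite unit_interval_ballE !(val_iter_restriction fF) !pP.
      by apply/negP; rewrite -leNgt.
    (* Separated points are distinct, so the [2 ^ n] words give [2 ^ n] points. *)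
    have pinj : injective p.
      move=> w w' e; apply/eqP/negPn/negP => /sep[i _].
      by rewrite e; apply; apply: ballxx; lra.
    exists [fset p w | w in {: n.-tuple bool}]%fset.
      move=> x y /imfsetP[w _ ->] /imfsetP[w' _ ->] pww'.
      by apply: sep; apply: contra_neq pww' => ->.
    by rewrite card_imfset//= -cardE card_tuple card_bool.
  move=> e e0; have [k kP] := @folded_tent_coverable R m e e0.
  exists k => n E sE; exact: (restriction_separated fF (kP n) sE).
Qed.
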